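(* Let $D,\lambda>0$ with $D/\lambda\ge 1/2$. For $\theta\in[0,\pi]$ let $d^{\mathrm N}=d^{\mathrm N}(\theta)\ge 0$ be the Fresnel distance function of the phased array of largest dimension $D$ at wavelength $\lambda$, i.e. the solution of $$\frac{D^3}{\lambda}|\cos\theta|\sin^2(\theta)\left(1+\min\left\{1,\frac{2d^{\mathrm N}|\cos\theta|}{D}\right\}\right)^3=(d^{\mathrm N})^2.$$ Let $\theta_1^{\mathrm N}\le\theta_2^{\mathrm N}$ be the solutions in $[0,\pi/2]$, and $\widetilde\theta_1^{\mathrm N}\le\widetilde\theta_2^{\mathrm N}$ the solutions in $[\pi/2,\pi]$, of $16|\cos^3\theta|\sin^2\theta=\frac{\lambda}{2D}$. Then $$d^{\mathrm N}(\theta)=\begin{cases}\sqrt{8|\cos\theta|\sin^2\theta\,\dfrac{D^3}{\lambda}}, & \text{if }\theta\in[\theta_1^{\mathrm N},\theta_2^{\mathrm N}]\cup[\widetilde\theta_1^{\mathrm N},\widetilde\theta_2^{\mathrm N}],\\[4pt] y(\theta), & \text{otherwise},\end{cases}$$ where $y(\theta)$ is the root $y\ge 0$, in the region $2y|\cos\theta|<D$, of the cubic polynomial equation $$\frac1\lambda|\cos\theta|\sin^2(\theta)\left(D+2y|\cos\theta|\right)^3-y^2=0.$$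
   Context: Here $D$ is the largest dimension of a phased array antenna (uniform linear array), $\lambda$ is the wavelength, and $\theta$ is the observation angle between the antenna plane and the line joining the antenna center to the source. The third-order phase term at separation $d'$ and distance $r$ has magnitude $|\Delta\theta_3|=\frac{\pi}{\lambda}|\cos\theta|\sin^2(\theta)(d')^3r^{-2}$. The Fresnel distance function of the phased array is the value of $r$ for which this equals $\pi/8$ when $d'=D/2+\min\{|r\cos\theta|,D/2\}$; this is the equation displayed in the claim, which is used as the definition of $d^{\mathrm N}(\theta)$. *)

(* Defs.v *)
From Stdlib Require Import Reals.
Open Scope R_scope.

(* The defining equation is
     (PI / lam) |cos theta| sin^2 theta d'^3 / d^2 = PI / 8
   at d' = D/2 + min (|d cos theta|, D/2), cleared of its denominator; thus
   d = 0 is the solution when |cos theta| sin^2 theta = 0. *)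
Definition is_fresnel_distance (D lam theta d : R) : Prop :=
  0 <= d /\
  D ^ 3 / lam * Rabs (cos theta) * sin theta ^ 2 *
    (1 + Rmin 1 (2 * d * Rabs (cos theta) / D)) ^ 3 = d ^ 2.

Definition transition_equation (D lam theta : R) : Prop :=
  16 * Rabs (cos theta ^ 3) * sin theta ^ 2 = lam / (2 * D).

(* t1 <= t2 list all the solutions in [a, b], not merely two of them. *)
Definition are_transition_angles (D lam a b t1 t2 : R) : Prop :=
  t1 <= t2 /\
  forall theta : R,
    (a <= theta <= b /\ transition_equation D lam theta) <->
    (theta = t1 \/ theta = t2).

Definition is_cubic_root (D lam theta y : R) : Prop :=
  0 <= y /\ 2 * y * Rabs (cos theta) < D /\
  1 / lam * Rabs (cos theta) * sin theta ^ 2 *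
    (D + 2 * y * Rabs (cos theta)) ^ 3 - y ^ 2 = 0.

(* Main.v *)
(** Write c = |cos theta| and u = 2 d c / D.  For c > 0 the defining equation
    becomes 4 (D/lam) c^3 sin^2 theta = u^2 / (1 + min(1,u))^3, whose right-hand
    side is strictly increasing in u and takes the value 1/8 at u = 1.  Hence
    the solution is unique, and u >= 1 exactly when
    16 c^3 sin^2 theta >= lam / (2 D).  As c^3 (1 - c^2) increases up to
    c = sqrt (3/5), where it exceeds 1/16, and decreases afterwards, this
    happens exactly between the two transition angles of each quadrant. *)

Require Import Defs.
From Stdlib Require Import Reals Lra Psatz.
Open Scope R_scope.

(** * The scalar equation A (1 + min(1, k x))^3 = x^2 *)

(** Strict growth of x^2 / (1 + min(1, k x))^3, cross-multiplied to avoid division. The cases are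
    whether [k * a] and [k * b] have reached the clipping value 1. *)
Lemma clipped_cube_lt (k a b : R) : 0 <= k -> 0 < a < b ->
  a ^ 2 * (1 + Rmin 1 (k * b)) ^ 3 < b ^ 2 * (1 + Rmin 1 (k * a)) ^ 3.
Proof.
intros hk [ha hab].
assert (hkab : k * a <= k * b) by nra.
destruct (Rle_dec 1 (k * a)) as [h1 | h1].
- rewrite !Rmin_left by lra. nra.
- rewrite (Rmin_right 1 (k * a)) by lra.
  destruct (Rle_dec 1 (k * b)) as [h2 | h2].
  + rewrite Rmin_left by lra.
    assert (hu : 0 <= k * a) by nra.
    assert (hk0 : 0 < k) by nra.
    assert (hv : 1 <= (k * b) ^ 2) by nra.
    (* With u = k a < 1, the difference (1 + u)^3 - 8 u^2 factors as (1 - u)(1 + 4u - u^2). *)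
    assert (h8 : 8 * (k * a) ^ 2 < (1 + k * a) ^ 3).
    { assert (0 < (1 - k * a) * (1 + 4 * (k * a) - (k * a) ^ 2))
        by (apply Rmult_lt_0_compat; nra).
      nra. }
    assert (0 < (1 + k * a) ^ 3) by (apply pow_lt; lra).
    (* Scaling by k^2 leaves only k a and k b, and then [h8] combines with (k b)^2 >= 1. *)
    apply (Rmult_lt_reg_l (k ^ 2)); [nra |].
    replace (k ^ 2 * (a ^ 2 * (1 + 1) ^ 3)) with (8 * (k * a) ^ 2) by ring.
    replace (k ^ 2 * (b ^ 2 * (1 + k * a) ^ 3))
      with ((k * b) ^ 2 * (1 + k * a) ^ 3) by ring.
    nra.
  + rewrite Rmin_right by lra.
    assert (hkp : 0 <= k * a * b)
      by (apply Rmult_le_pos; [apply Rmult_le_pos |]; lra).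
    assert (hq : (k * a) * (k * b) <= 1) by nra.
    (* This product is exactly b^2 (1 + k a)^3 - a^2 (1 + k b)^3. The negative term is at most k a b
       by [hq], so 3 k a b absorbs it. *)
    assert (hfac : 0 < (b - a) * (a + b + 3 * (k * a * b)
                   - (k * a * b) * ((k * a) * (k * b))))
      by (apply Rmult_lt_0_compat; nra).
    nra.
Qed.

Lemma clipped_equation_unique (A k a b : R) : 0 <= k -> 0 <= a -> 0 <= b ->
  A * (1 + Rmin 1 (k * a)) ^ 3 = a ^ 2 ->
  A * (1 + Rmin 1 (k * b)) ^ 3 = b ^ 2 -> a = b.
Proof.
intros hk.
assert (hlt : forall x y, 0 <= x -> x < y ->
  A * (1 + Rmin 1 (k * x)) ^ 3 = x ^ 2 ->
  A * (1 + Rmin 1 (k * y)) ^ 3 = y ^ 2 -> False).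
{ intros x y hx hxy ex ey.
  assert (hm : 0 <= Rmin 1 (k * x)) by (apply Rmin_glb; nra).
  assert (hc : 0 < (1 + Rmin 1 (k * x)) ^ 3) by (apply pow_lt; lra).
  destruct hx as [hx | hx].
  - pose proof (clipped_cube_lt k x y hk (conj hx hxy)) as hs.
    assert (hA : 0 < A) by nra.
    apply (Rmult_lt_compat_l A) in hs; [| exact hA].
    replace (A * (x ^ 2 * (1 + Rmin 1 (k * y)) ^ 3))
      with (x ^ 2 * (A * (1 + Rmin 1 (k * y)) ^ 3)) in hs by ring.
    replace (A * (y ^ 2 * (1 + Rmin 1 (k * x)) ^ 3))
      with (y ^ 2 * (A * (1 + Rmin 1 (k * x)) ^ 3)) in hs by ring.
    rewrite ex, ey in hs. lra.
  (* At x = 0 the clipped factor is 1, so A = 0 and the other solution must vanish too. *)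
  - subst x.
    assert (hA : A = 0) by nra.
    subst A. nra. }
intros ha hb ea eb.
destruct (Rtotal_order a b) as [h | [h | h]]; [| exact h |]; exfalso; eauto.
Qed.

(** Intermediate value theorem on [0, sqrt(8 A)]: the clipped cube never exceeds 2^3 = 8, so x^2 has
    caught up at the right endpoint. *)
Lemma clipped_equation_exists (A k : R) : 0 <= A -> 0 <= k ->
  exists d, 0 <= d /\ A * (1 + Rmin 1 (k * d)) ^ 3 = d ^ 2.
Proof.
intros hA hk.
(* Writing min(1, u) as (1 + u - |1 - u|) / 2 reduces continuity to that of the absolute value. *)
set (f := fun x => x ^ 2 - A * (1 + (1 + k * x - Rabs (1 - k * x)) * / 2) ^ 3).
assert (hf : forall x, f x = x ^ 2 - A * (1 + Rmin 1 (k * x)) ^ 3).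
{ intros x. unfold f. do 4 f_equal.
  unfold Rmin, Rabs. destruct (Rle_dec 1 (k * x)), (Rcase_abs (1 - k * x)); lra. }
assert (hcont : continuity f).
{ unfold f. intros x.
  assert (hin : continuity_pt (fun t => Rabs (1 - k * t)) x).
  { apply (continuity_pt_comp (fun t => 1 - k * t) Rabs).
    - reg.
    - apply Rcontinuity_abs. }
  apply continuity_pt_minus; [reg |].
  apply continuity_pt_mult; [reg |].
  apply (continuity_pt_comp
           (fun t => 1 + (1 + k * t - Rabs (1 - k * t)) * / 2) (fun t => t ^ 3));
    [| reg].
  apply continuity_pt_plus; [reg |].
  apply continuity_pt_mult; [| reg].
  apply continuity_pt_minus; [reg | exact hin]. }
pose proof (sqrt_pos (8 * A)) as hs.
assert (hs2 : sqrt (8 * A) ^ 2 = 8 * A) by (apply pow2_sqrt; lra).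
destruct (IVT_cor f 0 (sqrt (8 * A)) hcont hs) as [z [hz ez]].
- rewrite !hf, hs2.
  set (m := Rmin 1 (k * sqrt (8 * A))).
  assert (hm0 : 0 <= m) by (apply Rmin_glb; nra).
  assert (hm1 : m <= 1) by apply Rmin_l.
  replace (Rmin 1 (k * 0)) with 0 by (rewrite Rmin_right; lra).
  assert (h8 : (1 + m) ^ 3 <= 2 ^ 3) by (apply pow_incr; lra).
  assert (0 <= 8 * A - A * (1 + m) ^ 3) by nra.
  nra.
- exists z. rewrite hf in ez. split; lra.
Qed.

(** * The Fresnel distance: existence, uniqueness, and its two regimes *)

Lemma fresnel_clipped (D lam theta d : R) :
  is_fresnel_distance D lam theta d <->
  0 <= d /\
  D ^ 3 / lam * Rabs (cos theta) * sin theta ^ 2 *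
    (1 + Rmin 1 (2 * Rabs (cos theta) / D * d)) ^ 3 = d ^ 2.
Proof.
unfold is_fresnel_distance.
replace (2 * Rabs (cos theta) / D * d) with (2 * d * Rabs (cos theta) / D)
  by (unfold Rdiv; ring).
reflexivity.
Qed.

Lemma fresnel_slope_ge0 (D theta : R) : 0 < D -> 0 <= 2 * Rabs (cos theta) / D.
Proof.
intros hD. pose proof (Rabs_pos (cos theta)).
apply Rle_mult_inv_pos; lra.
Qed.

Lemma fresnel_coeff_ge0 (D lam theta : R) : 0 < D -> 0 < lam ->
  0 <= D ^ 3 / lam * Rabs (cos theta) * sin theta ^ 2.
Proof.
intros hD hlam.
apply Rmult_le_pos; [apply Rmult_le_pos |].
- apply Rle_mult_inv_pos; [apply pow_le; lra | exact hlam].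
- apply Rabs_pos.
- apply pow2_ge_0.
Qed.

Lemma fresnel_distance_unique (D lam theta d d' : R) : 0 < D ->
  is_fresnel_distance D lam theta d -> is_fresnel_distance D lam theta d' ->
  d = d'.
Proof.
intros hD [h0 h1]%fresnel_clipped [h0' h1']%fresnel_clipped.
exact (clipped_equation_unique _ _ _ _ (fresnel_slope_ge0 D theta hD)
         h0 h0' h1 h1').
Qed.

Lemma fresnel_distance_exists (D lam theta : R) : 0 < D -> 0 < lam ->
  exists d, is_fresnel_distance D lam theta d.
Proof.
intros hD hlam.
destruct (clipped_equation_exists _ _ (fresnel_coeff_ge0 D lam theta hD hlam)
            (fresnel_slope_ge0 D theta hD)) as [d hd].
exists d. now apply fresnel_clipped.
Qed.

(** In this region the minimum is not clipped, and D^3 moves inside the cube. *)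
Lemma cubic_root_fresnel (D lam theta y : R) : 0 < D -> 0 < lam ->
  2 * y * Rabs (cos theta) < D ->
  (is_cubic_root D lam theta y <-> is_fresnel_distance D lam theta y).
Proof.
intros hD hlam hy.
unfold is_cubic_root, is_fresnel_distance.
rewrite Rmin_right.
2: { apply (Rmult_le_reg_r D); [exact hD |].
     unfold Rdiv. rewrite Rmult_assoc, Rinv_l; lra. }
replace (D ^ 3 / lam * Rabs (cos theta) * sin theta ^ 2 *
         (1 + 2 * y * Rabs (cos theta) / D) ^ 3)
  with (1 / lam * Rabs (cos theta) * sin theta ^ 2 *
        (D + 2 * y * Rabs (cos theta)) ^ 3) by (field; lra).
split; [intros (h0 & _ & h) | intros (h0 & h)]; repeat split; lra.
Qed.

(** The second inequality is the first one multiplied by the positive factor 2 D^3 / lam. It decides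
    whether the closed-form candidate lies in the clipped region. *)
Lemma transition_level (D lam theta d : R) : 0 < D -> 0 < lam ->
  d ^ 2 = 8 * Rabs (cos theta) * sin theta ^ 2 * (D ^ 3 / lam) ->
  (lam / (2 * D) <= 16 * Rabs (cos theta ^ 3) * sin theta ^ 2 <->
   D ^ 2 <= (2 * d * Rabs (cos theta)) ^ 2).
Proof.
intros hD hlam hd.
replace ((2 * d * Rabs (cos theta)) ^ 2)
  with (4 * Rabs (cos theta) ^ 2 * d ^ 2) by ring.
rewrite hd, <- RPow_abs.
set (v := 16 * Rabs (cos theta) ^ 3 * sin theta ^ 2).
replace (4 * Rabs (cos theta) ^ 2 *
         (8 * Rabs (cos theta) * sin theta ^ 2 * (D ^ 3 / lam)))
  with (2 * D ^ 3 / lam * v) by (unfold v; field; lra).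
replace (D ^ 2) with (2 * D ^ 3 / lam * (lam / (2 * D))) by (field; lra).
assert (0 < 2 * D ^ 3 / lam).
{ apply Rdiv_lt_0_compat; [| exact hlam]. pose proof (pow_lt D 3 hD). lra. }
split; intros h.
- apply Rmult_le_compat_l; lra.
- apply (Rmult_le_reg_l (2 * D ^ 3 / lam)); lra.
Qed.

Lemma fresnel_distance_far (D lam theta : R) : 0 < D -> 0 < lam ->
  lam / (2 * D) <= 16 * Rabs (cos theta ^ 3) * sin theta ^ 2 ->
  is_fresnel_distance D lam theta
    (sqrt (8 * Rabs (cos theta) * sin theta ^ 2 * (D ^ 3 / lam))).
Proof.
intros hD hlam hlev.
pose proof (fresnel_coeff_ge0 D lam theta hD hlam) as hA.
set (d := sqrt _).
assert (hd0 : 0 <= d) by apply sqrt_pos.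
assert (hd : d ^ 2 = 8 * Rabs (cos theta) * sin theta ^ 2 * (D ^ 3 / lam))
  by (apply pow2_sqrt; lra).
apply (transition_level D lam theta d hD hlam hd) in hlev.
assert (hu : D <= 2 * d * Rabs (cos theta)).
{ pose proof (Rabs_pos (cos theta)).
  assert (0 <= 2 * d * Rabs (cos theta)) by (apply Rmult_le_pos; lra).
  nra. }
split; [exact hd0 |].
rewrite Rmin_left.
- rewrite hd. ring.
- apply (Rmult_le_reg_r D); [exact hD |].
  unfold Rdiv. rewrite Rmult_assoc, Rinv_l; lra.
Qed.

(** By contraposition: a clipped minimum turns the defining equation into the closed form for d^2,
    and [transition_level] then puts theta at or above the level. *)
Lemma fresnel_distance_near (D lam theta d : R) : 0 < D -> 0 < lam ->
  ~ lam / (2 * D) <= 16 * Rabs (cos theta ^ 3) * sin theta ^ 2 ->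
  is_fresnel_distance D lam theta d -> 2 * d * Rabs (cos theta) < D.
Proof.
intros hD hlam hlev [hd0 hd].
apply Rnot_le_lt. intros hu. apply hlev.
apply (transition_level D lam theta d hD hlam).
- rewrite Rmin_left in hd.
  + rewrite <- hd. ring.
  + apply (Rmult_le_reg_r D); [exact hD |].
    unfold Rdiv. rewrite Rmult_assoc, Rinv_l; lra.
- apply pow_incr; lra.
Qed.

(** * Monotonicity and superlevel sets of the quintic *)

(** The left-hand side of the transition equation in the variable x = cos theta, for theta in the
    first quadrant. *)
Definition quintic (x : R) : R := 16 * x ^ 3 * (1 - x ^ 2).

(** Taking out y - x replaces the derivative: the sign depends only on a form of degree 2 compared
    with one of degree 4. *)
Lemma quintic_diff (x y : R) :
  quintic y - quintic x =
  16 * (y - x) * (x ^ 2 + x * y + y ^ 2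
    - (x ^ 4 + x ^ 3 * y + x ^ 2 * y ^ 2 + x * y ^ 3 + y ^ 4)).
Proof. unfold quintic. ring. Qed.

(** The threshold 3/5 is the square of the critical point, since x^3 - x^5 has derivative x^2 (3 - 5
    x^2). *)
Lemma quintic_increasing (x y : R) : 0 <= x < y -> y ^ 2 <= 3 / 5 ->
  quintic x < quintic y.
Proof.
intros [hx hxy] hy.
apply Rlt_0_minus. rewrite quintic_diff.
apply Rmult_lt_0_compat; [lra |].
set (p := x ^ 2 + x * y + y ^ 2).
assert (hy2 : 0 < y ^ 2) by nra.
(* Multiply by 3 >= 5 y^2 to make the comparison homogeneous. *)
assert (hhom : 3 * (x ^ 4 + x ^ 3 * y + x ^ 2 * y ^ 2 + x * y ^ 3 + y ^ 4)
               < 5 * (y ^ 2 * p)).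
{ assert (h3 : x ^ 2 <= x * y /\ x * y <= y ^ 2) by nra.
  assert (h4 : 0 <= x * y) by nra.
  unfold p.
  assert (x ^ 3 * y <= x ^ 2 * y ^ 2) by nra.
  assert (x ^ 4 <= x ^ 2 * y ^ 2) by nra.
  assert (x ^ 2 * y ^ 2 <= x * y ^ 3) by nra.
  assert (x * y ^ 3 < y ^ 4).
  { replace (x * y ^ 3) with (y ^ 3 * x) by ring.
    replace (y ^ 4) with (y ^ 3 * y) by ring.
    apply Rmult_lt_compat_l; [apply pow_lt; lra | lra]. }
  nra. }
assert (0 < p) by (unfold p; nra).
nra.
Qed.

Lemma quintic_decreasing (x y : R) : 0 <= x < y -> 3 / 5 <= x ^ 2 ->
  quintic y < quintic x.
Proof.
intros [hx hxy] hx2.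
apply Rminus_lt. rewrite quintic_diff.
set (p := x ^ 2 + x * y + y ^ 2).
set (q := x ^ 4 + x ^ 3 * y + x ^ 2 * y ^ 2 + x * y ^ 3 + y ^ 4).
assert (hx0 : 0 < x) by nra.
(* The smaller point x now supplies the homogenizing factor: 3 <= 5 x^2 gives 3 p <= 5 x^2 p < 3
   q. *)
assert (hhom : 5 * (x ^ 2 * p) < 3 * q).
{ unfold p, q.
  assert (x ^ 2 < x * y /\ x * y < y ^ 2) by nra.
  assert (x ^ 4 < x * y ^ 3) by nra.
  assert (x ^ 3 * y < x * y ^ 3) by nra.
  assert (x ^ 2 * y ^ 2 < y ^ 4) by nra.
  assert (x * y ^ 3 < y ^ 4) by nra.
  nra. }
assert (0 < p) by (unfold p; nra).
assert (p < q) by nra.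
assert (0 < 16 * (y - x) * (q - p)) by (apply Rmult_lt_0_compat; lra).
lra.
Qed.

Lemma quintic_superlevel (v : R) : 0 < v <= 1 ->
  exists x1 x2, 0 < x1 < x2 /\ x2 < 1 /\
    quintic x1 = v /\ quintic x2 = v /\
    (forall x, 0 <= x <= 1 -> (v <= quintic x <-> x1 <= x <= x2)) /\
    (forall x, 0 <= x <= 1 -> quintic x = v -> x = x1 \/ x = x2).
Proof.
intros hv.
set (m := sqrt (3 / 5)).
assert (hm2 : m ^ 2 = 3 / 5) by (apply pow2_sqrt; lra).
assert (hm0 : 0 <= m) by apply sqrt_pos.
assert (hm : 3 / 4 <= m < 1) by nra.
assert (hcont : continuity (fun x => quintic x - v))
  by (unfold quintic; reg).
(* At the peak the value is 16 (3/5)(2/5) m = 3.84 m, and m >= 3/4. *)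
assert (hqm : 1 < quintic m).
{ unfold quintic. replace (m ^ 3) with (m * m ^ 2) by ring. rewrite hm2. nra. }
assert (hq0 : quintic 0 = 0) by (unfold quintic; ring).
assert (hq1 : quintic 1 = 0) by (unfold quintic; ring).
(* The quintic vanishes at 0 and 1 and exceeds v at m, so the level is attained on each side of the
   peak. *)
destruct (IVT_cor _ 0 m hcont) as [x1 [hx1 e1]]; [lra | nra |].
destruct (IVT_cor _ m 1 hcont) as [x2 [hx2 e2]]; [lra | nra |].
cbv beta in e1, e2.
assert (n10 : x1 <> 0) by (intros ->; lra).
assert (n1m : x1 <> m) by (intros ->; lra).
assert (n2m : x2 <> m) by (intros ->; lra).
assert (n21 : x2 <> 1) by (intros ->; lra).
assert (inc : forall x y, 0 <= x < y -> y <= m -> quintic x < quintic y)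
  by (intros x y hxy hy; apply quintic_increasing; [exact hxy | nra]).
assert (dec : forall x y, m <= x < y -> quintic y < quintic x)
  by (intros x y hxy; apply quintic_decreasing; nra).
assert (hcmp : forall x, 0 <= x <= 1 ->
  (x < x1 -> quintic x < v) /\ (x1 < x < x2 -> v < quintic x) /\
  (x2 < x -> quintic x < v)).
{ intros x hx. repeat split; intros h.
  - pose proof (inc x x1). lra.
  - destruct (Rle_dec x m).
    + pose proof (inc x1 x). lra.
    + pose proof (dec x x2). lra.
  - pose proof (dec x2 x). lra. }
exists x1, x2.
split; [lra |]. split; [lra |]. split; [lra |]. split; [lra |]. split.
- intros x hx. destruct (hcmp x hx) as (h1 & h2 & h3). split.
  + intros h. split; apply Rnot_lt_le; intros h'; [pose proof (h1 h') | pose proof (h3 h')]; lra.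
  + intros [[hl | hl] [hr | hr]]; subst; lra.
- intros x hx hq. destruct (hcmp x hx) as (h1 & h2 & h3).
  destruct (Rtotal_order x x1) as [h | [h | h]]; [lra | tauto |].
  destruct (Rtotal_order x x2) as [h' | [h' | h']]; [lra | tauto | lra].
Qed.

(** * Transition angles and the superlevel set in theta *)

Lemma transition_quintic (theta : R) : 0 <= theta <= PI / 2 ->
  16 * Rabs (cos theta ^ 3) * sin theta ^ 2 = quintic (cos theta) /\
  0 <= cos theta <= 1.
Proof.
intros h. pose proof PI_RGT_0.
assert (hc : 0 <= cos theta) by (apply cos_ge_0; lra).
pose proof (COS_bound theta).
split; [| lra].
rewrite Rabs_right by (apply Rle_ge, pow_le, hc).
unfold quintic. pose proof (sin2 theta) as hs. unfold Rsqr in hs.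
replace (sin theta ^ 2) with (1 - cos theta * cos theta)
  by (rewrite <- hs; ring).
ring.
Qed.

Lemma cos_le_iff (x y : R) : 0 <= x <= PI -> 0 <= y <= PI ->
  (cos x <= cos y <-> y <= x).
Proof.
intros hx hy. split; intros h.
- apply cos_decr_0; tauto || lra.
- apply cos_decr_1; lra.
Qed.

(** Here [D / lam >= 1 / 2] enters: it keeps the level below the peak of the quintic, so that both
    transition angles exist. *)
Lemma transition_level_bounds (D lam : R) : 0 < D -> 0 < lam ->
  D / lam >= 1 / 2 -> 0 < lam / (2 * D) <= 1.
Proof.
intros hD hlam h. split.
- apply Rdiv_lt_0_compat; lra.
- assert (h2 : D / lam * lam = D) by (field; lra).
  apply (Rmult_le_reg_r (2 * D)); [lra |].
  replace (lam / (2 * D) * (2 * D)) with lam by (field; lra).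
  nra.
Qed.

Lemma acos_level (x : R) : 0 <= x <= 1 ->
  0 <= acos x <= PI / 2 /\ cos (acos x) = x.
Proof.
intros hx. pose proof (acos_bound x). pose proof PI_RGT_0.
assert (hc : cos (acos x) = x) by (apply cos_acos; lra).
split; [| exact hc]. split; [lra |].
apply cos_le_iff; [lra | lra |]. rewrite cos_PI2. lra.
Qed.

Lemma transition_angles_superlevel (D lam : R) : 0 < D -> 0 < lam ->
  D / lam >= 1 / 2 ->
  exists t1 t2, are_transition_angles D lam 0 (PI / 2) t1 t2 /\
    forall theta, 0 <= theta <= PI / 2 ->
      (t1 <= theta <= t2 <->
       lam / (2 * D) <= 16 * Rabs (cos theta ^ 3) * sin theta ^ 2).
Proof.
intros hD hlam h. pose proof PI_RGT_0.
destruct (quintic_superlevel _ (transition_level_bounds D lam hD hlam h))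
  as (x1 & x2 & hx1 & hx2 & e1 & e2 & hlev & huniq).
destruct (acos_level x1) as [b1 c1]; [lra |].
destruct (acos_level x2) as [b2 c2]; [lra |].
(* The cosine decreases on [0, PI/2], so the larger root of the quintic gives the smaller angle. *)
exists (acos x2), (acos x1). split; [split |].
- apply cos_le_iff; lra.
- intros theta. unfold transition_equation. split.
  + intros [hth heq].
    destruct (transition_quintic theta hth) as [hq hc]. rewrite hq in heq.
    destruct (huniq _ hc heq) as [hx | hx]; [right | left];
      rewrite <- hx, acos_cos; lra.
  + intros [-> | ->].
    * split; [exact b2 |].
      rewrite (proj1 (transition_quintic _ b2)), c2. exact e2.
    * split; [exact b1 |].
      rewrite (proj1 (transition_quintic _ b1)), c1. exact e1.
- intros theta hth.
  destruct (transition_quintic theta hth) as [hq hc].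
  rewrite hq, (hlev _ hc).
  pose proof (cos_le_iff (acos x1) theta) as l1.
  pose proof (cos_le_iff theta (acos x2)) as l2.
  rewrite c1 in l1. rewrite c2 in l2. lra.
Qed.

(** Transfers what is known of the angles built from arccosines to any given pair. Both pairs list
    the same set, and their order fixes which member is which. *)
Lemma transition_angles_unique (D lam a b t1 t2 u1 u2 : R) :
  are_transition_angles D lam a b t1 t2 ->
  are_transition_angles D lam a b u1 u2 -> t1 = u1 /\ t2 = u2.
Proof.
intros [ht it] [hu iu].
assert (hiff : forall x, x = t1 \/ x = t2 <-> x = u1 \/ x = u2)
  by (intros x; rewrite <- it, <- iu; reflexivity).
pose proof (proj1 (hiff t1) (or_introl eq_refl)).
pose proof (proj1 (hiff t2) (or_intror eq_refl)).
pose proof (proj2 (hiff u1) (or_introl eq_refl)).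
pose proof (proj2 (hiff u2) (or_intror eq_refl)).
lra.
Qed.

Lemma transition_value_reflect (theta : R) :
  16 * Rabs (cos (PI - theta) ^ 3) * sin (PI - theta) ^ 2 =
  16 * Rabs (cos theta ^ 3) * sin theta ^ 2.
Proof.
rewrite Rtrigo_facts.cos_pi_minus, Rtrigo_facts.sin_pi_minus.
rewrite <- !RPow_abs, Rabs_Ropp. reflexivity.
Qed.

(** The map theta -> PI - theta preserves the transition equation and reverses order, which carries
    results from one quadrant to the other. *)
Lemma transition_angles_reflect (D lam a b t1 t2 : R) :
  are_transition_angles D lam a b t1 t2 ->
  are_transition_angles D lam (PI - b) (PI - a) (PI - t2) (PI - t1).
Proof.
intros [ht it]. split; [lra |].
intros theta. specialize (it (PI - theta)).
unfold transition_equation in *. rewrite transition_value_reflect in it.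
split.
- intros [hth he].
  destruct (proj1 it) as [h | h]; [split; [lra | exact he] | right | left]; lra.
- intros hth. destruct (proj2 it) as [h he]; [lra |]. split; [lra | exact he].
Qed.

Lemma transition_superlevel_left (D lam t1 t2 theta : R) : 0 < D -> 0 < lam ->
  D / lam >= 1 / 2 -> are_transition_angles D lam 0 (PI / 2) t1 t2 ->
  0 <= theta <= PI / 2 ->
  (t1 <= theta <= t2 <->
   lam / (2 * D) <= 16 * Rabs (cos theta ^ 3) * sin theta ^ 2).
Proof.
intros hD hlam h ht.
destruct (transition_angles_superlevel D lam hD hlam h) as (u1 & u2 & hu & hlev).
destruct (transition_angles_unique _ _ _ _ _ _ _ _ ht hu) as [-> ->].
apply hlev.
Qed.

Lemma transition_superlevel_right (D lam s1 s2 theta : R) : 0 < D -> 0 < lam ->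
  D / lam >= 1 / 2 -> are_transition_angles D lam (PI / 2) PI s1 s2 ->
  PI / 2 <= theta <= PI ->
  (s1 <= theta <= s2 <->
   lam / (2 * D) <= 16 * Rabs (cos theta ^ 3) * sin theta ^ 2).
Proof.
intros hD hlam h hs hth.
apply transition_angles_reflect in hs.
replace (PI - PI) with 0 in hs by ring.
replace (PI - PI / 2) with (PI / 2) in hs by field.
rewrite <- transition_value_reflect.
rewrite <- (transition_superlevel_left D lam _ _ (PI - theta) hD hlam h hs)
  by lra.
lra.
Qed.

Lemma transition_superlevel (D lam t1 t2 s1 s2 theta : R) : 0 < D -> 0 < lam ->
  D / lam >= 1 / 2 -> are_transition_angles D lam 0 (PI / 2) t1 t2 ->
  are_transition_angles D lam (PI / 2) PI s1 s2 -> 0 <= theta <= PI ->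
  ((t1 <= theta <= t2 \/ s1 <= theta <= s2) <->
   lam / (2 * D) <= 16 * Rabs (cos theta ^ 3) * sin theta ^ 2).
Proof.
intros hD hlam h ht hs hth.
(* As solutions, t2 <= PI/2 and s1 >= PI/2, so each interval stays in the quadrant where its lemma
   applies. *)
pose proof (proj1 (proj2 (proj2 ht t2) (or_intror eq_refl))) as bt.
pose proof (proj1 (proj2 (proj2 hs s1) (or_introl eq_refl))) as bs.
pose proof (transition_superlevel_left D lam t1 t2 theta hD hlam h ht) as il.
pose proof (transition_superlevel_right D lam s1 s2 theta hD hlam h hs) as ir.
split.
- intros [hin | hin]; [apply il | apply ir]; lra.
- intros hlev. destruct (Rle_dec theta (PI / 2)).
  + left. apply il; lra.
  + right. apply ir; lra.
Qed.

(** * Assembly of the piecewise formula for the Fresnel distance *)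

Theorem mainTheorem3 (D lam : R) (hD : 0 < D) (hlam : 0 < lam)
    (hDlam : D / lam >= 1 / 2) :
  (forall theta : R, 0 <= theta <= PI ->
     exists! d : R, is_fresnel_distance D lam theta d) /\
  (exists t1 t2 : R, are_transition_angles D lam 0 (PI / 2) t1 t2) /\
  (exists s1 s2 : R, are_transition_angles D lam (PI / 2) PI s1 s2) /\
  (forall (dN : R -> R) (t1 t2 s1 s2 : R),
     (forall theta : R, 0 <= theta <= PI ->
        is_fresnel_distance D lam theta (dN theta)) ->
     are_transition_angles D lam 0 (PI / 2) t1 t2 ->
     are_transition_angles D lam (PI / 2) PI s1 s2 ->
     forall theta : R, 0 <= theta <= PI ->
       ((t1 <= theta <= t2 \/ s1 <= theta <= s2) ->
          dN theta = sqrt (8 * Rabs (cos theta) * sin theta ^ 2 * (D ^ 3 / lam))) /\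
       (~ (t1 <= theta <= t2 \/ s1 <= theta <= s2) ->
          exists y : R, unique (is_cubic_root D lam theta) y /\ dN theta = y)).
Proof.
destruct (transition_angles_superlevel D lam hD hlam hDlam)
  as (u1 & u2 & hu & _).
repeat split.
- intros theta _.
  destruct (fresnel_distance_exists D lam theta hD hlam) as [d hd].
  exists d. split; [exact hd |].
  intros d' hd'. exact (fresnel_distance_unique D lam theta d d' hD hd hd').
- now exists u1, u2.
- exists (PI - u2), (PI - u1).
  apply transition_angles_reflect in hu.
  replace (PI - 0) with PI in hu by ring.
  now replace (PI - PI / 2) with (PI / 2) in hu by field.
- rewrite (transition_superlevel D lam t1 t2 s1 s2 theta) by assumption.
  intros hlev.
  apply (fresnel_distance_unique D lam theta); [assumption | auto |].
  now apply fresnel_distance_far.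
- rewrite (transition_superlevel D lam t1 t2 s1 s2 theta) by assumption.
  (* The Fresnel distance is itself the cubic root. Any other root in the region is again a Fresnel
     distance, so uniqueness carries over. *)
  intros hlev. exists (dN theta). split; [| reflexivity].
  assert (hd : is_fresnel_distance D lam theta (dN theta)) by auto.
  split.
  + apply cubic_root_fresnel; try assumption.
    now apply (fresnel_distance_near D lam).
  + intros y hy.
    apply (fresnel_distance_unique D lam theta); try assumption.
    apply cubic_root_fresnel; try assumption. apply hy.
Qed.
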